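(* Let $s=(u_1,u_2,u_3)$ be a state with real coordinates $x_i=\sigma_r(u_i)>0$ and slopes $\zeta_i=\zeta(u_i)$. Let $V=(v_{ij})\in\mathrm{GL}_3(\mathbb Z)$ be an admissible move, producing $u_i'=\sum_jv_{ij}u_j$ with $x_i':=\sigma_r(u_i')>0$. Then for each $i$ $$\zeta(u_i')=\sum_j\pi_{ij}\zeta_j,\qquad \pi_{ij}:=\frac{v_{ij}x_j}{x_i'},\qquad \sum_j\pi_{ij}=1,\quad \pi_{ij}\in\mathbb R .$$ That is, each new slope is an affine (in general non-convex) barycenter of the old slopes with real weights.
   Context: $K$ is a cubic number field of signature $(1,1)$, with real embedding $\sigma_r$ and complex embedding $\sigma_c$; $L\subset\mathcal O_K$ is an order. A state is an ordered triple of elements of $L$ forming a $\mathbb Q$-basis of $K$ with positive real embeddings. The slope of $u\in K^\times$ is $\zeta(u):=\sigma_c(u)/\sigma_r(u)\in\mathbb C$. A move $V\in\mathrm{GL}_3(\mathbb Z)$ is admissible at $s$ when the new real coordinates $x_i'=\sigma_r(u_i')$ are all positive. *)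

(* Defs.v *)
From HB Require Import structures.
From mathcomp Require Import all_boot all_order all_algebra all_field.
From mathcomp Require Import reals complex.
Set Implicit Arguments. Unset Strict Implicit. Unset Printing Implicit Defensive.
Import Order.TTheory GRing.Theory Num.Theory.
Local Open Scope ring_scope.
Local Open Scope complex_scope.

Definition nonreal_embedding (R : realType) (K : fieldExtType rat)
    (tau : {rmorphism K -> R[i]}) : Prop :=
  exists x : K, complex.Im (tau x) != 0.

(* [rho] lists the real embeddings without repetition; [tau] lists the
   non-real embeddings, one per pair of complex conjugates. *)
Definition has_signature (R : realType) (K : fieldExtType rat)
    (r1 r2 : nat) : Prop :=
  exists (rho : 'I_r1 -> {rmorphism K -> R})
         (tau : 'I_r2 -> {rmorphism K -> R[i]}),
  [/\ forall i i', rho i =1 rho i' -> i = i',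
      forall phi : {rmorphism K -> R}, exists i, phi =1 rho i,
      forall j, nonreal_embedding (tau j),
      forall j j', tau j =1 tau j' \/ tau j =1 conjc \o tau j' -> j = j'
    & forall phi : {rmorphism K -> R[i]}, nonreal_embedding phi ->
        exists j, phi =1 tau j \/ phi =1 conjc \o tau j].

Definition is_order (K : fieldExtType rat) (L : {pred K}) : Prop :=
  [/\ subring_closed L,
      forall x, x \in L -> integralOver (intr : int -> K) x
    & exists2 b : (\dim {:K}).-tuple K,
        basis_of {:K} b & forall x, x \in L <-> inIntSpan b x].

Definition is_state (R : realType) (K : fieldExtType rat) (L : {pred K})
    (sigma_r : {rmorphism K -> R}) (u : 3.-tuple K) : Prop :=
  [/\ forall i, tnth u i \in L,
      basis_of {:K} u
    & forall i, 0 < sigma_r (tnth u i)].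

Definition slope (R : realType) (K : fieldExtType rat)
    (sigma_r : {rmorphism K -> R}) (sigma_c : {rmorphism K -> R[i]})
    (u : K) : R[i] :=
  sigma_c u / (sigma_r u)%:C.

Definition move (K : fieldExtType rat) (V : 'M[int]_3) (u : 3.-tuple K) :
    3.-tuple K :=
  [tuple \sum_(j < 3) (V i j)%:~R * tnth u j | i < 3].

Definition admissible (R : realType) (K : fieldExtType rat)
    (sigma_r : {rmorphism K -> R}) (u : 3.-tuple K) (V : 'M[int]_3) : Prop :=
  V \in unitmx /\ forall i, 0 < sigma_r (tnth (move V u) i).

Definition weight (R : realType) (K : fieldExtType rat)
    (sigma_r : {rmorphism K -> R}) (V : 'M[int]_3) (u : 3.-tuple K)
    (i j : 'I_3) : R :=
  (V i j)%:~R * sigma_r (tnth u j) / sigma_r (tnth (move V u) i).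

(* Main.v *)
Require Import Defs.
From HB Require Import structures.
From mathcomp Require Import all_boot all_order all_algebra all_field.
From mathcomp Require Import reals complex.
Set Implicit Arguments. Unset Strict Implicit. Unset Printing Implicit Defensive.
Import Order.TTheory GRing.Theory Num.Theory.
Local Open Scope ring_scope.
Local Open Scope complex_scope.

(** The barycentric formula is a regrouping: with x = sigma_r u, one has
    sigma_c u = x * slope u, so applying sigma_c to u'_i = sum_j v_ij u_j
    and dividing by x'_i turns each coefficient v_ij into the weight
    v_ij x_j / x'_i.  The same computation with sigma_r in place of sigma_c
    gives the normalisation of the weights.
    These are [slope_move] and [sum_weight].

    The barycenters are genuinely non-convex for every order.  Any integral
    basis of the order becomes a state after flipping the signs of those
    entries whose real embedding is negative ([exists_state]).  From a state
    u, replace u_1 by n u_0 - u_1, where n is so large that n x_0 > x_1; this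
    is triangular with diagonal entries 1, -1, 1, so it is an admissible
    move, and it gives u_1 the weight - x_1 / (n x_0 - x_1) < 0
    ([exists_negative_weight]). *)

Lemma sigma_move (K : fieldExtType rat) (S : pzRingType)
    (sigma : {rmorphism K -> S}) (V : 'M[int]_3) (u : 3.-tuple K) (i : 'I_3) :
  sigma (tnth (move V u) i) =
    \sum_(j < 3) (V i j)%:~R * sigma (tnth u j).
Proof.
rewrite tnth_mktuple rmorph_sum; apply: eq_bigr => j _.
by rewrite rmorphM rmorph_int.
Qed.

Section Barycenter.
Variables (R : realType) (K : fieldExtType rat).
Variables (sigma_r : {rmorphism K -> R}) (sigma_c : {rmorphism K -> R[i]}).
Variables (V : 'M[int]_3) (u : 3.-tuple K) (i : 'I_3).

Lemma sum_weight :
  sigma_r (tnth (move V u) i) != 0 ->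
  \sum_(j < 3) weight sigma_r V u i j = 1.
Proof.
by move=> x'_neq0; rewrite -mulr_suml -sigma_move divff.
Qed.

(** The real coordinate x_j cancels between the j-th weight and the j-th
    slope, leaving v_ij sigma_c u_j / x'_i. *)
Lemma slope_move :
  (forall j, sigma_r (tnth u j) != 0) ->
  slope sigma_r sigma_c (tnth (move V u) i) =
    \sum_(j < 3) (weight sigma_r V u i j)%:C *
                 slope sigma_r sigma_c (tnth u j).
Proof.
move=> x_neq0; rewrite /slope sigma_move mulr_suml; apply: eq_bigr => j _.
rewrite /weight !rmorphM fmorphV rmorph_int -!mulrA; congr (_ * _).
have xC_neq0 : (sigma_r (tnth u j))%:C != 0 :> R[i] by rewrite fmorph_eq0.
by rewrite [RHS]mulrC -!mulrA mulVf // mulr1 mulrC.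
Qed.

End Barycenter.

Lemma mem_inIntSpan (M : zmodType) (m : nat) (b : m.-tuple M) (i : 'I_m) :
  inIntSpan b b`_i.
Proof.
exists [ffun j => (j == i)%:Z]; rewrite (bigD1 i) //= ffunE eqxx.
rewrite big1 ?addr0 // => j /negPf j_neq_i.
by rewrite ffunE j_neq_i.
Qed.

Lemma basis_sign (F : fieldType) (vT : vectType F) (m : nat)
    (U : {vspace vT}) (b : m.-tuple vT) (e : 'I_m -> bool) :
  basis_of U b -> basis_of U [tuple (-1) ^+ e i *: tnth b i | i < m].
Proof.
move=> b_basis; rewrite basisEdim size_tuple (size_basis b_basis) leqnn.
rewrite andbT -(span_basis b_basis); apply/span_subvP => v /tnthP[i ->].
have -> : tnth b i = (-1) ^+ e i *: ((-1) ^+ e i *: tnth b i).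
  by rewrite scalerA -expr2 sqrr_sign scale1r.
apply: memvZ; apply: memv_span; apply/tnthP; exists i.
by rewrite tnth_mktuple.
Qed.

(** An integral basis of L is made positive by changing signs: no real
    embedding of a basis element vanishes, and L is closed under opposites. *)
Lemma exists_state (R : realType) (K : fieldExtType rat) (L : {pred K})
    (sigma_r : {rmorphism K -> R}) :
  \dim {:K} = 3%N -> is_order L -> exists u, is_state L sigma_r u.
Proof.
move=> degK [[L1 LB LM] _ []]; rewrite degK => b b_basis Lb.
pose e i := sigma_r (tnth b i) < 0.
have bL i : tnth b i \in L.
  by apply/Lb; rewrite (tnth_nth 0); exact: mem_inIntSpan.
exists [tuple (-1) ^+ e i *: tnth b i | i < 3]; split=> [i||i].
- rewrite tnth_mktuple; case: (e i); rewrite ?expr0 ?scale1r //.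
  have L0 : 0 \in L by rewrite -(subrr 1); exact: (LB 1 1).
  by rewrite expr1 scaleN1r -(sub0r (tnth b i)); apply: LB.
- exact: basis_sign.
- have b_neq0 : sigma_r (tnth b i) != 0.
    by rewrite fmorph_eq0 (free_not0 (basis_free b_basis)) ?mem_tnth.
  rewrite tnth_mktuple scaler_sign (fun_if sigma_r) rmorphN {}/e.
  by case: (ltrgt0P (sigma_r _)) b_neq0; rewrite ?oppr_gt0.
Qed.

Definition flip_move (n : nat) : 'M[int]_3 :=
  \matrix_(i, j) if i == 1 then n%:Z *+ (j == 0) - (j == 1)%:Z
                 else (i == j)%:Z.

Lemma flip_move_unit (n : nat) : flip_move n \in unitmx.
Proof.
have trig : is_trig_mx (flip_move n).
  apply/is_trig_mxP => i j; rewrite mxE.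
  by case: i j => [[|[|[|//]]] ?] [[|[|[|//]]] ?].
by rewrite unitmxE det_trig // !big_ord_recl big_ord0 !mxE /=.
Qed.

Lemma tnth_flip_move (K : fieldExtType rat) (n : nat) (u : 3.-tuple K) i :
  tnth (move (flip_move n) u) i =
    if i == 1 then n%:R * tnth u 0 - tnth u 1 else tnth u i.
Proof.
rewrite tnth_mktuple; case: ifPn => [/eqP-> | i_neq1].
  rewrite !big_ord_recl big_ord0 !mxE /=.
  rewrite (_ : lift ord0 ord0 = 1); last exact: val_inj.
  by rewrite subr0 sub0r mulrN1z mul0r !addr0 mulN1r.
rewrite (bigD1 i) //= mxE (negPf i_neq1) eqxx mul1r big1 ?addr0 // => j.
by rewrite mxE (negPf i_neq1) eq_sym => /negPf->; rewrite mul0r.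
Qed.

(** The Archimedean property makes the new coordinate n x_0 - x_1 positive
    for some n; its positivity is exactly what makes the weight of u_1
    negative. *)
Lemma exists_negative_weight (R : realType) (K : fieldExtType rat)
    (L : {pred K}) (sigma_r : {rmorphism K -> R}) (u : 3.-tuple K) :
  is_state L sigma_r u ->
  exists2 V, admissible sigma_r u V &
    exists i j : 'I_3, weight sigma_r V u i j < 0.
Proof.
move=> [_ _ x_gt0].
have [n nP] : exists n, sigma_r (tnth u 1) < n%:R * sigma_r (tnth u 0).
  have q_ge0 : 0 <= sigma_r (tnth u 1) / sigma_r (tnth u 0).
    by rewrite divr_ge0 ?ltW.
  exists (Num.bound (sigma_r (tnth u 1) / sigma_r (tnth u 0))).
  by rewrite -ltr_pdivrMr //; exact: archi_boundP.
have x'_gt0 i : 0 < sigma_r (tnth (move (flip_move n) u) i).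
  rewrite tnth_flip_move; case: ifP => // _.
  by rewrite rmorphB rmorphM rmorph_nat subr_gt0.
exists (flip_move n); first by split; [exact: flip_move_unit | exact: x'_gt0].
exists 1, 1; rewrite /weight pmulr_llt0 ?invr_gt0 //.
by rewrite mxE /= mulNr mul1r oppr_lt0.
Qed.

Theorem proposition3p1 (R : realType) (K : fieldExtType rat)
    (degK : \dim {:K} = 3%N) (sigK : has_signature R K 1 1)
    (sigma_r : {rmorphism K -> R})
    (sigma_c : {rmorphism K -> R[i]}) (sigma_cP : nonreal_embedding sigma_c)
    (L : {pred K}) (orderL : is_order L) :
  (forall (u : 3.-tuple K) (V : 'M[int]_3),
     is_state L sigma_r u -> admissible sigma_r u V ->
     forall i : 'I_3,
       slope sigma_r sigma_c (tnth (move V u) i) =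
         \sum_(j < 3) (weight sigma_r V u i j)%:C *
                      slope sigma_r sigma_c (tnth u j)
       /\ \sum_(j < 3) weight sigma_r V u i j = 1)
  /\
  (exists (u : 3.-tuple K) (V : 'M[int]_3),
     [/\ is_state L sigma_r u, admissible sigma_r u V
       & exists i j : 'I_3, weight sigma_r V u i j < 0]).
Proof.
split=> [u V [_ _ x_gt0] [_ x'_gt0] i|].
  by split; [apply: slope_move => j | apply: sum_weight]; rewrite gt_eqF.
have [u uP] := exists_state sigma_r degK orderL.
have [V VP neg] := exists_negative_weight uP.
by exists u, V; split.
Qed.
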